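(* Let $C\subset\mathbf{L}^3$ be the elliptic catenoid of axis $(0,0,1)$. (a) For $t\in\mathbb{R}$, $t\neq 0$, the dual surface $H_t(C)^\sharp$ of the image of $C$ by the hyperbolic rotation $H_t$ about $(1,0,0)$ is a Bonnet minimal surface of $\mathbf{E}^3$. (b) For $t\in\mathbb{R}$, the dual surface $P_t(C)^\sharp$ of the image of $C$ by the parabolic rotation $P_t$ about $(1,0,1)$ is a Goursat transformation of a Bonnet minimal surface.
   Context: $\mathbf{E}^3$ and $\mathbf{L}^3$ denote $\mathbb{R}^3$ with the metric $dx^2+dy^2+\epsilon\,dz^2$, with $\epsilon=1$ and $\epsilon=-1$ respectively. A (conformal) minimal surface of $\mathbf{E}^3$ ($\epsilon=1$) or maximal surface of $\mathbf{L}^3$ ($\epsilon=-1$) is given on a simply-connected domain $\Omega\subset\mathbb{C}$ by $X(z)=X(z_0)+\Re\int_{z_0}^z\phi(w)\,dw$, where the isotropic curve $\phi=2\,\partial X/\partial z:\Omega\to\mathbb{C}^3$ is holomorphic, $\phi_1^2+\phi_2^2+\epsilon\phi_3^2=0$ and $|\phi_1|^2+|\phi_2|^2+\epsilon|\phi_3|^2\not\equiv 0$ (the induced metric may degenerate at some points). Its Weierstrass representation is $(g,\omega)$ with $g=\phi_3/(\phi_1-i\phi_2)$, $\omega=(\phi_1-i\phi_2)dz$, so that $\phi\,dz=\left(\tfrac12(1-\epsilon g^2)\omega,\tfrac i2(1+\epsilon g^2)\omega,g\omega\right)$. Dual surface: if $M$ is maximal in $\mathbf{L}^3$ with isotropic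 curve $\psi$, then $M^\sharp$ is the minimal surface of $\mathbf{E}^3$ with isotropic curve $(i\psi_1,i\psi_2,\psi_3)$, defined up to translations. Surfaces of $\mathbf{E}^3$ are considered up to reparametrization, orientation-preserving isometries and dilations of $\mathbf{E}^3$. The elliptic catenoid $C$ of axis $(0,0,1)$ is the maximal surface with $g=e^z$, $\omega=e^{-z}dz$ on $\mathbb{C}$, with isotropic curve $\psi(z)=(\cosh z,-i\sinh z,1)$. The rotations are $$H_t=\begin{pmatrix}1&0&0\\0&\cosh t&\sinh t\\0&\sinh t&\cosh t\end{pmatrix},\qquad P_t=\begin{pmatrix}1-\frac{t^2}{2}&t&\frac{t^2}{2}\\-t&1&t\\-\frac{t^2}{2}&t&1+\frac{t^2}{2}\end{pmatrix}.$$ The Bonnet minimal surfaces of $\mathbf{E}^3$ are, up to congruences and dilations, the surfaces $\mathcal{B}(\lambda)$, $\lambda\in(0,\infty)$, with Weierstrass representation $g(z)=e^z+\lambda$, $\omega=e^{-z}dz$ on $\mathbb{C}$. A Goursat transformation of a minimal surface of $\mathbf{E}^3$ with isotropic curve $\phi$ is the minimal surface with isotropic curve $A\phi$, where $A\in O(3,\mathbb{C})$; in terms of Weierstrass data, $(g,\omega)$ changes into $(T(g),\omega/T'(g))$ for a Möbius transformation $T$ of $\mathbb{C}\cup\{\infty\}$. *)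

(* Defs.v *)
From HB Require Import structures.
From mathcomp Require Import all_boot all_order all_algebra complex.
From mathcomp Require Import all_classical all_reals all_analysis.
Set Implicit Arguments.
Unset Strict Implicit.
Unset Printing Implicit Defensive.
Import Order.TTheory GRing.Theory Num.Theory numFieldNormedType.Exports.
Local Open Scope classical_set_scope.
Local Open Scope ring_scope.

(* [R[i]] itself carries no topology; its regular module [R[i]^o], normed over
   [R[i]], does.  In particular [derivable f z 1] for [f : Cplx R -> Cplx R] is
   complex differentiability at [z]. *)
Notation Cplx R := ((R[i])^o).

Section Complex_plane.
Variable R : realType.

Definition cexp (z : Cplx R) : Cplx R :=
  (expR (complex.Re z) * cos (complex.Im z)
    +i* (expR (complex.Re z) * sin (complex.Im z)))%C.

Definition holomorphic_on (D : set (Cplx R)) (f : Cplx R -> Cplx R) : Prop :=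
  forall z, D z -> derivable f z 1.

Definition biholomorphic (D E : set (Cplx R)) (h : Cplx R -> Cplx R) : Prop :=
  holomorphic_on D h /\ set_bij D E h.

(* [H (s, _)] is the loop at time [s] of a homotopy with fixed base point. *)
Definition null_homotopic_in (D : set (Cplx R)) (gamma : R -> Cplx R) : Prop :=
  exists H : R * R -> Cplx R,
    [/\ {within `[0, 1] `*` `[0, 1], continuous H},
        forall s u, s \in `[0, 1] -> u \in `[0, 1] -> D (H (s, u)),
        forall u, u \in `[0, 1] -> H (0, u) = gamma u,
        forall u, u \in `[0, 1] -> H (1, u) = gamma 0 &
        forall s, s \in `[0, 1] -> H (s, 0) = gamma 0 /\ H (s, 1) = gamma 0].

Definition simply_connected (D : set (Cplx R)) : Prop :=
  connected D /\
  forall gamma : R -> Cplx R,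
    {within `[0, 1], continuous gamma} ->
    (forall u, u \in `[0, 1] -> D (gamma u)) ->
    gamma 0 = gamma 1 ->
    null_homotopic_in D gamma.

Definition simply_connected_domain (D : set (Cplx R)) : Prop :=
  [/\ open D, D !=set0 & simply_connected D].

End Complex_plane.

Section Surfaces.
Variable R : realType.

Definition col3 (K : nzRingType) (a b c : K) : 'cV[K]_3 :=
  \col_(j < 3) nth 0 [:: a; b; c] j.

Definition mx3 (K : nzRingType) (rows : seq (seq K)) : 'M[K]_3 :=
  \matrix_(i < 3, j < 3) nth 0 (nth [::] rows i) j.

(* A parametrized surface; the values of [pos] outside [dom] are irrelevant. *)
Record surface := Surface {
  dom : set (Cplx R);
  pos : Cplx R -> 'cV[R]_3
}.

Definition x_slice (S : surface) (z : Cplx R) (j : 'I_3) : R -> R :=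
  fun x => pos S (x +i* complex.Im z)%C j 0.

Definition y_slice (S : surface) (z : Cplx R) (j : 'I_3) : R -> R :=
  fun y => pos S (complex.Re z +i* y)%C j 0.

Definition has_partials (S : surface) : Prop :=
  forall z (j : 'I_3), dom S z ->
    derivable (x_slice S z j) (complex.Re z) 1 /\
    derivable (y_slice S z j) (complex.Im z) 1.

(* phi = 2 dX/dz = X_x - i X_y, where z = x + i y. *)
Definition isotropic_curve (S : surface) (z : Cplx R) : 'cV[R[i]]_3 :=
  \col_j (derive1 (x_slice S z j) (complex.Re z)
            +i* - derive1 (y_slice S z j) (complex.Im z))%C.

(* [eps = 1]: minimal surfaces of E^3; [eps = -1]: maximal surfaces of L^3.
   On a simply connected domain, X_x - i X_y = phi with phi holomorphic says
   exactly that X(z) = X(z0) + Re \int_z0^z phi. *)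
Definition conformal_surface (eps : R) (S : surface) : Prop :=
  let phi := isotropic_curve S in
  [/\ simply_connected_domain (dom S),
      has_partials S,
      forall j, holomorphic_on (dom S) (fun z => phi z j 0),
      forall z, dom S z ->
        phi z 0 0 ^+ 2 + phi z 1 0 ^+ 2 + eps%:C%C * phi z 2 0 ^+ 2 = 0 &
      exists2 z, dom S z &
        `|phi z 0 0| ^+ 2 + `|phi z 1 0| ^+ 2
          + eps%:C%C * `|phi z 2 0| ^+ 2 != 0].

Definition minimal_surface : surface -> Prop := conformal_surface 1.
Definition maximal_surface : surface -> Prop := conformal_surface (-1).

(* The isotropic curve with Weierstrass data (g, w dz), at a point where
   g and w take the (finite) values [g] and [w]. *)
Definition weierstrass (eps : R) (g w : R[i]) : 'cV[R[i]]_3 :=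
  col3 (2^-1 * (1 - eps%:C%C * g ^+ 2) * w)
       ('i%C / 2 * (1 + eps%:C%C * g ^+ 2) * w)
       (g * w).

Definition has_weierstrass_data (eps : R) (S : surface)
    (g w : Cplx R -> Cplx R) : Prop :=
  forall z, dom S z -> isotropic_curve S z = weierstrass eps (g z) (w z).

Definition image_surface (A : 'M[R]_3) (S : surface) : surface :=
  Surface (dom S) (fun z => A *m pos S z).

(* Duals are defined up to translation, so this is a set of surfaces. *)
Definition dual_surface (S : surface) : set surface :=
  [set M | [/\ maximal_surface S, minimal_surface M, dom M = dom S &
    forall z, dom S z ->
      let psi := isotropic_curve S z in
      isotropic_curve M z = col3 ('i%C * psi 0 0) ('i%C * psi 1 0) (psi 2 0)]].

(* [T] is [S] up to reparametrization, orientation-preserving isometry and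
   dilation of E^3. *)
Definition similar_surfaces (S T : surface) : Prop :=
  exists (h : Cplx R -> Cplx R) (A : 'M[R]_3) (r : R) (b : 'cV[R]_3),
    [/\ biholomorphic (dom T) (dom S) h,
        A *m A^T = 1%:M, \det A = 1, 0 < r &
        forall z, dom T z -> pos T z = r *: (A *m pos S (h z)) + b].

Definition goursat_transform (S T : surface) : Prop :=
  [/\ minimal_surface S, minimal_surface T, dom T = dom S &
    exists2 A : 'M[R[i]]_3, A *m A^T = 1%:M &
      forall z, dom S z -> isotropic_curve T z = A *m isotropic_curve S z].

(* Up to translation. *)
Definition elliptic_catenoid (S : surface) : Prop :=
  [/\ maximal_surface S, dom S = setT &
      has_weierstrass_data (-1) S (@cexp R) (fun z => cexp (- z))].

Definition bonnet_model (lambda : R) (S : surface) : Prop :=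
  [/\ minimal_surface S, dom S = setT &
      has_weierstrass_data 1 S (fun z => cexp z + lambda%:C%C)
                               (fun z => cexp (- z))].

Definition bonnet_surface (S : surface) : Prop :=
  minimal_surface S /\
  exists (lambda : R) (B : surface),
    [/\ 0 < lambda, bonnet_model lambda B & similar_surfaces B S].

Definition ch (t : R) : R := (expR t + expR (- t)) / 2.
Definition sh (t : R) : R := (expR t - expR (- t)) / 2.

Definition hyperbolic_rotation (t : R) : 'M[R]_3 :=
  mx3 [:: [:: 1; 0; 0];
          [:: 0; ch t; sh t];
          [:: 0; sh t; ch t]].

Definition parabolic_rotation (t : R) : 'M[R]_3 :=
  mx3 [:: [:: 1 - t ^+ 2 / 2; t; t ^+ 2 / 2];
          [:: - t; 1; t];
          [:: - (t ^+ 2 / 2); t; 1 + t ^+ 2 / 2]].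

End Surfaces.

(* Main.v *)
(* Up to the factors dual_mx = diag(i, i, 1), the isotropic curve of the dual of
   A(C), A a Lorentz matrix, is A psi with psi = (cosh z, - i sinh z, 1).  Its
   real primitive mixes the catenoid with its adjoint surface, which gives
   existence.  For A = H_t and sg the sign of t, the dual curve at z + b, where
   e^b = i sg / cosh t, is the image under a rotation of E^3 of the Bonnet curve
   with lambda = |sinh t| at z.  Any two Lorentz images of psi have dual curves
   related by a constant complex orthogonal matrix, so every dual of P_t(C) is
   the Goursat transform of a dual of H_1(C). *)
Require Import Defs.
From mathcomp Require Import all_boot all_order all_algebra complex.
From mathcomp Require Import all_classical all_reals all_analysis.
From mathcomp Require Import ring lra.
Import Order.TTheory GRing.Theory Num.Theory numFieldNormedType.Exports.
Local Open Scope classical_set_scope.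
Local Open Scope ring_scope.

Set Implicit Arguments.
Unset Strict Implicit.
Unset Printing Implicit Defensive.

(** * Coordinates of vectors and matrices of size three *)

Lemma sum_ord3 (V : nmodType) (F : 'I_3 -> V) :
  \sum_(i < 3) F i = F 0 + F 1 + F 2.
Proof.
rewrite !big_ord_recl big_ord0 addr0 addrA.
by congr (F _ + F _ + F _); apply: val_inj.
Qed.

Lemma ord3_case (P : 'I_3 -> Prop) : P 0 -> P 1 -> P 2 -> forall j, P j.
Proof.
move=> P0 P1 P2 [[|[|[|//]]] lt_j].
- by rewrite (_ : Ordinal lt_j = 0) //; apply: val_inj.
- by rewrite (_ : Ordinal lt_j = 1) //; apply: val_inj.
- by rewrite (_ : Ordinal lt_j = 2) //; apply: val_inj.
Qed.

Lemma cV3P (K : nzRingType) (u v : 'cV[K]_3) :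
  u 0 0 = v 0 0 -> u 1 0 = v 1 0 -> u 2 0 = v 2 0 -> u = v.
Proof.
move=> e0 e1 e2; apply/colP; exact: ord3_case.
Qed.

Lemma col3E (K : nzRingType) (a b c : K) :
  (col3 a b c 0 0 = a) * (col3 a b c 1 0 = b) * (col3 a b c 2 0 = c).
Proof. by rewrite !mxE. Qed.

Lemma mulmx_col3 (K : nzRingType) (A : 'M[K]_3) (u : 'cV[K]_3) (i : 'I_3) :
  (A *m u) i 0 = A i 0 * u 0 0 + A i 1 * u 1 0 + A i 2 * u 2 0.
Proof. by rewrite mxE sum_ord3. Qed.

Lemma mulmx_mx3 (K : nzRingType) (A B : 'M[K]_3) (i j : 'I_3) :
  (A *m B) i j = A i 0 * B 0 j + A i 1 * B 1 j + A i 2 * B 2 j.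
Proof. by rewrite mxE sum_ord3. Qed.

Lemma det_mx33 (K : comNzRingType) (A : 'M[K]_3) :
  \det A = A 0 0 * (A 1 1 * A 2 2 - A 1 2 * A 2 1)
         - A 0 1 * (A 1 0 * A 2 2 - A 1 2 * A 2 0)
         + A 0 2 * (A 1 0 * A 2 1 - A 1 1 * A 2 0).
Proof.
(* Cofactor expansion produces nested lifts of ordinals. Reading every entry through [inord] of a
   natural number makes equal indices syntactically equal for [ring]. *)
pose a i j := A (inord i) (inord j).
have aE i j : A i j = a i j by rewrite /a !inord_val.
have -> : (2 : 'I_3) = inord 2 by apply: val_inj; rewrite /= inordK.
have -> : (1 : 'I_3) = inord 1 by apply: val_inj; rewrite /= inordK.
rewrite !(expand_det_row _ ord0) !big_ord_recl !big_ord0 /cofactor.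
rewrite !(expand_det_row _ ord0) !big_ord_recl !big_ord0 /cofactor !det_mx11.
rewrite !mxE !aE /= /bump /= !(addn0, add0n, addn1) !inordK //.
ring.
Qed.

(** * Derivatives of translated functions *)

Lemma comp_shift_shift (V : zmodType) (T : Type) (f : V -> T) (a x : V) :
  (fun y => f (y + a)) \o shift x = f \o shift (x + a).
Proof. by apply/funext => y /=; rewrite addrA. Qed.

Lemma derivable_shift (K : numFieldType) (V W : normedModType K) (f : V -> W)
    (a x v : V) :
  derivable f (x + a) v -> derivable (fun y => f (y + a)) x v.
Proof. by rewrite /derivable comp_shift_shift. Qed.

Lemma is_derive_shift (K : numFieldType) (V W : normedModType K) (f : V -> W)
    (a x v : V) (df : W) :
  is_derive (x + a) v f df -> is_derive x v (fun y => f (y + a)) df.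
Proof.
move=> [dfx <-]; apply: DeriveDef; first exact: derivable_shift.
by rewrite /derive comp_shift_shift.
Qed.

(** * Isotropic curves under translations and linear maps *)

Section Isotropic_curves.
Variable R : realType.
Implicit Types (S C M : surface R) (A : 'M[R]_3) (phi psi : Cplx R -> 'cV[R[i]]_3).

(** Since phi = X_x - i X_y, its real part is X_x and its imaginary part is - X_y. Using [is_derive]
    bundles the existence of the partial derivatives with their values. *)
Definition has_isotropic_curve S phi : Prop :=
  forall z (j : 'I_3), dom S z ->
    is_derive (complex.Re z) 1 (x_slice S z j) (complex.Re (phi z j 0)) /\
    is_derive (complex.Im z) 1 (y_slice S z j) (- complex.Im (phi z j 0)).

Lemma has_isotropic_curveP S phi :
  has_isotropic_curve S phi <->
  has_partials S /\ forall z, dom S z -> isotropic_curve S z = phi z.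
Proof.
split=> [Sphi | [dS Sphi]].
  split=> [z j Dz | z Dz].
    have [dx dy] := Sphi z j Dz; split; exact: ex_derive.
  apply/colP => j; have [dx dy] := Sphi z j Dz.
  rewrite mxE !derive1E.
  rewrite (@derive_val _ _ _ _ _ _ _ dx) (@derive_val _ _ _ _ _ _ _ dy) opprK.
  by case: (phi z j 0).
move=> z j Dz; rewrite -(Sphi z Dz) mxE /= opprK !derive1E.
by have [dx dy] := dS z j Dz; split; [exact: (derivableP dx)|exact: (derivableP dy)].
Qed.

Lemma eq_has_isotropic_curve S phi psi :
  phi =1 psi -> has_isotropic_curve S phi -> has_isotropic_curve S psi.
Proof. by move=> /funext ->. Qed.

Definition translate (a : Cplx R) S : surface R :=
  Surface [set z | dom S (z + a)] (fun z => pos S (z + a)).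

Lemma translate_isotropic_curve a S phi :
  has_isotropic_curve S phi ->
  has_isotropic_curve (translate a S) (fun z => phi (z + a)).
Proof.
(* With [a] and [z] split into real and imaginary parts, a slice of the translated surface is by
   computation a translated slice of [S]. *)
case: a => a b Sphi [x y] j /= Dz; have [dx dy] := Sphi _ j Dz.
by split; [exact: is_derive_shift dx | exact: is_derive_shift dy].
Qed.

Definition complex_mx m n (A : 'M[R]_(m, n)) : 'M[R[i]]_(m, n) :=
  map_mx (real_complex R) A.

Lemma ReM_real (a : R) (z : R[i]) :
  complex.Re (a%:C%C * z) = a * complex.Re z.
Proof. by case: z => x y /=; rewrite mul0r subr0. Qed.

Lemma ImM_real (a : R) (z : R[i]) :
  complex.Im (a%:C%C * z) = a * complex.Im z.
Proof. by case: z => x y /=; rewrite mul0r addr0. Qed.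

Lemma ReD (z w : R[i]) : complex.Re (z + w) = complex.Re z + complex.Re w.
Proof. by case: z w => [? ?] []. Qed.

Lemma ImD (z w : R[i]) : complex.Im (z + w) = complex.Im z + complex.Im w.
Proof. by case: z w => [? ?] []. Qed.

(** A real matrix commutes with taking real and imaginary parts, hence with the passage from a
    surface to its curve. *)
Lemma image_isotropic_curve A S phi :
  has_isotropic_curve S phi ->
  has_isotropic_curve (image_surface A S) (fun z => complex_mx A *m phi z).
Proof.
move=> Sphi z j Dz.
have [dx0 dy0] := Sphi z 0 Dz; have [dx1 dy1] := Sphi z 1 Dz.
have [dx2 dy2] := Sphi z 2 Dz.
have -> : x_slice (image_surface A S) z j =
    A j 0 \*: x_slice S z 0 + A j 1 \*: x_slice S z 1 + A j 2 \*: x_slice S z 2.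
  by apply/funext => x; rewrite /x_slice /= mulmx_col3.
have -> : y_slice (image_surface A S) z j =
    A j 0 \*: y_slice S z 0 + A j 1 \*: y_slice S z 1 + A j 2 \*: y_slice S z 2.
  by apply/funext => y; rewrite /y_slice /= mulmx_col3.
rewrite mulmx_col3 !ReD !ImD !mxE !ReM_real !ImM_real.
split; first exact: is_deriveD.
by apply: is_derive_eq; rewrite !opprD -!mulrN.
Qed.

Lemma holomorphic_mulmx (A : 'M[R[i]]_3) phi :
  (forall j, holomorphic_on setT (fun z => phi z j 0)) ->
  forall j : 'I_3, holomorphic_on setT (fun z => (A *m phi z) j 0).
Proof.
move=> dphi j z _.
have -> : (fun z => (A *m phi z) j 0 : Cplx R) =
   A j 0 \*: (fun z => phi z 0 0 : Cplx R)
   + A j 1 \*: (fun z => phi z 1 0 : Cplx R)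
   + A j 2 \*: (fun z => phi z 2 0 : Cplx R).
  by apply/funext => w; rewrite mulmx_col3.
by apply: derivableD; first apply: derivableD; apply/derivableZ/dphi.
Qed.

Lemma holomorphic_shift (f : Cplx R -> Cplx R) (a : Cplx R) :
  holomorphic_on setT f -> holomorphic_on setT (fun z => f (z + a)).
Proof. by move=> df z _; apply/derivable_shift/df. Qed.

(** All surfaces below are defined on the whole plane, so this reduces conformality to properties of
    an explicit curve. *)
Lemma has_isotropic_curve_conformal eps S phi :
  dom S = setT -> has_isotropic_curve S phi ->
  simply_connected_domain [set: Cplx R] ->
  (forall j, holomorphic_on setT (fun z => phi z j 0)) ->
  (forall z, phi z 0 0 ^+ 2 + phi z 1 0 ^+ 2 + eps%:C%C * phi z 2 0 ^+ 2 = 0) ->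
  (exists z, `|phi z 0 0| ^+ 2 + `|phi z 1 0| ^+ 2
               + eps%:C%C * `|phi z 2 0| ^+ 2 != 0) ->
  conformal_surface eps S.
Proof.
move=> domS /has_isotropic_curveP [dS Sphi] sc dphi isophi [z0 nz].
rewrite domS in Sphi.
have eq_phi : isotropic_curve S = phi by apply/funext => z; exact: Sphi.
rewrite /conformal_surface eq_phi domS; split=> //.
by exists z0.
Qed.

Lemma euclidean_norm_neq0 (u : 'cV[R[i]]_3) :
  u != 0 -> `|u 0 0| ^+ 2 + `|u 1 0| ^+ 2 + 1%:C%C * `|u 2 0| ^+ 2 != 0.
Proof.
apply: contra_neq; rewrite mul1r => /eqP.
rewrite !paddr_eq0 ?addr_ge0 ?exprn_ge0 // !expf_eq0 !normr_eq0 /=.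
by case/andP => /andP[/eqP u0 /eqP u1] /eqP u2; apply: cV3P; rewrite mxE.
Qed.

(** * The Lorentz form and its linear isometries *)

Definition lorentz_form : 'M[R]_3 :=
  mx3 [:: [:: 1; 0; 0]; [:: 0; 1; 0]; [:: 0; 0; -1]].

Definition lorentz_mx (A : 'M[R]_3) : Prop :=
  A^T *m lorentz_form *m A = lorentz_form.

(** The form is extended to complex vectors bilinearly, not as a Hermitian form: the pair (u, u)
    gives the isotropy condition, the pair (u, conj u) the induced metric. *)
Lemma lorentz_formE (u v : 'cV[R[i]]_3) :
  (u^T *m complex_mx lorentz_form *m v) 0 0 =
  u 0 0 * v 0 0 + u 1 0 * v 1 0 - u 2 0 * v 2 0.
Proof.
rewrite -mulmxA mxE sum_ord3 !mulmx_col3 !mxE /=.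
rewrite !(rmorph0, rmorph1, rmorphN1) /=.
ring.
Qed.

Lemma lorentz_mulmx A (u v : 'cV[R[i]]_3) : lorentz_mx A ->
  ((complex_mx A *m u)^T *m complex_mx lorentz_form *m (complex_mx A *m v)) 0 0 =
  (u^T *m complex_mx lorentz_form *m v) 0 0.
Proof.
move=> hA; rewrite trmx_mul !mulmxA.
rewrite -3!(mulmxA u^T) -[in RHS]hA /complex_mx !map_mxM map_trmx.
by rewrite !mulmxA.
Qed.

(** As [A] is real, conjugation commutes with it, and [lorentz_mulmx] applies to u and its
    conjugate. *)
Lemma lorentz_norm A (u : 'cV[R[i]]_3) : lorentz_mx A ->
  let v := complex_mx A *m u in
  `|v 0 0| ^+ 2 + `|v 1 0| ^+ 2 + (-1)%:C%C * `|v 2 0| ^+ 2 =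
  `|u 0 0| ^+ 2 + `|u 1 0| ^+ 2 + (-1)%:C%C * `|u 2 0| ^+ 2.
Proof.
move=> hA v; rewrite !normCK.
have mapv : map_mx Num.conj v = complex_mx A *m map_mx Num.conj u.
  rewrite /v map_mxM; congr (_ *m _); apply/matrixP => i j; rewrite !mxE.
  exact: conjc_real.
have := lorentz_mulmx u (map_mx Num.conj u) hA.
rewrite -mapv !lorentz_formE !mxE => E.
by rewrite rmorphN1 !mulN1r.
Qed.

Lemma lorentz_sqr A (u : 'cV[R[i]]_3) : lorentz_mx A ->
  let v := complex_mx A *m u in
  v 0 0 ^+ 2 + v 1 0 ^+ 2 + (-1)%:C%C * v 2 0 ^+ 2 =
  u 0 0 ^+ 2 + u 1 0 ^+ 2 + (-1)%:C%C * u 2 0 ^+ 2.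
Proof.
move=> hA v; have := lorentz_mulmx u u hA.
by rewrite !lorentz_formE -/v => E; rewrite rmorphN1 !mulN1r.
Qed.

(** * The catenoid and its adjoint surface *)

Definition catenoid_curve (z : Cplx R) : 'cV[R[i]]_3 :=
  weierstrass (-1) (cexp z) (cexp (- z)).

Definition dual_mx : 'M[R[i]]_3 := diag_mx (\row_j nth 0 [:: 'i%C; 'i%C; 1] j).

Lemma dual_mxE (u : 'cV[R[i]]_3) :
  dual_mx *m u = col3 ('i%C * u 0 0) ('i%C * u 1 0) (u 2 0).
Proof. by apply: cV3P; rewrite mul_diag_mx !mxE //= mul1r. Qed.

Lemma cexpD (z w : Cplx R) : cexp (z + w) = cexp z * cexp w.
Proof.
case: z w => [a b] [c d]; rewrite /cexp /= expRD cosD sinD.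
by congr Complex; ring.
Qed.

Lemma cexp0 : cexp (0 : Cplx R) = 1.
Proof. by rewrite /cexp /= expR0 cos0 sin0 mulr1 mulr0. Qed.

Lemma cexpN_mul (z : Cplx R) : cexp (- z) * cexp z = 1.
Proof. by rewrite -cexpD addNr cexp0. Qed.

Lemma sqr_i : 'i%C ^+ 2 = -1 :> R[i].
Proof. by rewrite expr2; congr Complex; rewrite /=; ring. Qed.

Lemma catenoid_curveE z : catenoid_curve z =
  col3 ((cexp z + cexp (- z)) / 2) ('i%C / 2 * (cexp (- z) - cexp z)) 1.
Proof.
have e := cexpN_mul z.
rewrite /catenoid_curve /weierstrass rmorphN1 mulN1r opprK.
by apply: cV3P; rewrite !col3E; ring: e.
Qed.

(** Simple connectedness of the plane, holomorphy and nondegeneracy are contained in the maximality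
    of [C]. They are extracted once here and then serve for the images and the duals. *)
Lemma elliptic_catenoid_curve C : elliptic_catenoid C ->
  [/\ dom C = setT, has_isotropic_curve C catenoid_curve,
      simply_connected_domain [set: Cplx R],
      forall j, holomorphic_on setT (fun z => catenoid_curve z j 0) &
      exists z, `|catenoid_curve z 0 0| ^+ 2 + `|catenoid_curve z 1 0| ^+ 2
                 + (-1)%:C%C * `|catenoid_curve z 2 0| ^+ 2 != 0].
Proof.
move=> [[sc dC hol _ [z0 _ nz]] domC wC].
rewrite /has_weierstrass_data in wC; rewrite !domC in sc hol wC.
have eq_phi : isotropic_curve C = catenoid_curve.
  by apply/funext => z; exact: wC.
rewrite eq_phi in hol nz.
split; [exact: domC | | exact: sc | exact: hol | by exists z0].
by apply/has_isotropic_curveP; split=> [|z _]; [exact: dC | rewrite eq_phi].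
Qed.

Lemma catenoid_curve_isotropic z :
  catenoid_curve z 0 0 ^+ 2 + catenoid_curve z 1 0 ^+ 2
    + (-1)%:C%C * catenoid_curve z 2 0 ^+ 2 = 0.
Proof.
have e := cexpN_mul z; have i2 := sqr_i.
rewrite catenoid_curveE !col3E rmorphN1.
by field: e i2.
Qed.

(* - Im (sinh z, - i cosh z, z), where the vector is a primitive of
   catenoid_curve. *)
Definition adjoint_catenoid : surface R :=
  Surface setT (fun z =>
    col3 (- (ch (complex.Re z) * sin (complex.Im z)))
         (ch (complex.Re z) * cos (complex.Im z)) (- complex.Im z)).

Lemma is_derive_ch (x : R) : is_derive x 1 (@ch R) (sh x).
Proof.
rewrite /ch /sh; apply: is_derive_eq; rewrite /GRing.scale /=.
by ring.
Qed.

Lemma ccoshE (x y : R) (z := (x +i* y)%C) :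
  (cexp z + cexp (- z)) / 2 = (ch x * cos y +i* (sh x * sin y))%C.
Proof.
apply: (canLR (mulfK _)); first by rewrite pnatr_eq0.
rewrite mulr_natr mulr2n /cexp /= cosN sinN /ch /sh.
by congr Complex; field.
Qed.

Lemma csinhE (x y : R) (z := (x +i* y)%C) :
  (cexp z - cexp (- z)) / 2 = (sh x * cos y +i* (ch x * sin y))%C.
Proof.
apply: (canLR (mulfK _)); first by rewrite pnatr_eq0.
rewrite mulr_natr mulr2n /cexp /= cosN sinN /ch /sh.
by congr Complex; field.
Qed.

(** The surface is the real part of i F with F a holomorphic primitive of the catenoid curve, so its
    curve is i F'. With F explicit, this is checked by differentiating elementary real functions. *)
Lemma adjoint_catenoid_isotropic_curve :
  has_isotropic_curve adjoint_catenoid (fun z => 'i%C *: catenoid_curve z).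
Proof.
move=> [x y] + _; have dch := is_derive_ch x; have i2 := sqr_i.
have -> : 'i%C *: catenoid_curve (x +i* y)%C =
  col3 (- (sh x * sin y) +i* (ch x * cos y))%C
       (sh x * cos y +i* (ch x * sin y))%C 'i%C.
  rewrite catenoid_curveE; apply: cV3P; rewrite mxE !col3E ?mulr1 //.
    rewrite ccoshE; congr Complex; ring.
  rewrite -csinhE; by ring: i2.
apply: ord3_case; rewrite !col3E /= /x_slice /y_slice /=.
- split.
  + have -> : (fun a => col3 (- (ch a * sin y)) (ch a * cos y) (- y) 0 0) =
        (- sin y) \*: (@ch R).
      by apply/funext => a; rewrite col3E /= /GRing.scale /=; ring.
    by apply: is_derive_eq; rewrite /GRing.scale /=; ring.
  + have -> : (fun b => col3 (- (ch x * sin b)) (ch x * cos b) (- b) 0 0) =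
        (- ch x) \*: sin.
      by apply/funext => a; rewrite col3E /= /GRing.scale /=; ring.
    by apply: is_derive_eq; rewrite /GRing.scale /=; ring.
- split.
  + have -> : (fun a => col3 (- (ch a * sin y)) (ch a * cos y) (- y) 1 0) =
        cos y \*: (@ch R).
      by apply/funext => a; rewrite col3E /= /GRing.scale /=; ring.
    by apply: is_derive_eq; rewrite /GRing.scale /=; ring.
  + have -> : (fun b => col3 (- (ch x * sin b)) (ch x * cos b) (- b) 1 0) =
        ch x \*: cos.
      by apply/funext => a; rewrite col3E.
    by apply: is_derive_eq; rewrite /GRing.scale /=; ring.
- split.
  + have -> : (fun a => col3 (- (ch a * sin y)) (ch a * cos y) (- y) 2 0) =
        cst (- y).
      by apply/funext => a; rewrite col3E.
    exact: is_derive_cst.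
  + have -> : (fun b => col3 (- (ch x * sin b)) (ch x * cos b) (- b) 2 0) =
        -%R.
      by apply/funext => a; rewrite col3E.
    exact: is_deriveN.
Qed.

(** * Duals of Lorentz images of the catenoid *)

Lemma image_catenoid_maximal A C : elliptic_catenoid C -> lorentz_mx A ->
  maximal_surface (image_surface A C).
Proof.
move=> /elliptic_catenoid_curve [domC isoC sc hol [z0 nz]] hA.
have isoA := image_isotropic_curve (A := A) isoC.
apply: (has_isotropic_curve_conformal (S := image_surface A C) domC isoA).
- exact: sc.
- exact: holomorphic_mulmx.
- by move=> z; rewrite lorentz_sqr // catenoid_curve_isotropic.
- by exists z0; rewrite lorentz_norm.
Qed.

Definition dual_curve A (z : Cplx R) : 'cV[R[i]]_3 :=
  dual_mx *m (complex_mx A *m catenoid_curve z).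

(** The factors i change the sign of the first two squares, so the Euclidean square of the dual
    curve is minus the Lorentzian square of the original one. *)
Lemma dual_curve_isotropic A z : lorentz_mx A ->
  dual_curve A z 0 0 ^+ 2 + dual_curve A z 1 0 ^+ 2
    + 1%:C%C * dual_curve A z 2 0 ^+ 2 = 0.
Proof.
move=> hA; have := lorentz_sqr (catenoid_curve z) hA.
rewrite catenoid_curve_isotropic /dual_curve dual_mxE !col3E /=.
set v := _ *m _; rewrite rmorphN1 rmorph1 !exprMn !sqr_i => e.
by rewrite -[RHS]oppr0 -e; ring.
Qed.

Lemma dual_surface_catenoidP A C M : elliptic_catenoid C ->
  dual_surface (image_surface A C) M ->
  [/\ minimal_surface M, dom M = setT & has_isotropic_curve M (dual_curve A)].
Proof.
move=> /elliptic_catenoid_curve [domC isoC sc hol _] [_ minM domM eqM].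
split; [exact: minM | by rewrite domM |].
apply/has_isotropic_curveP; split; first by case: minM.
move=> z Mz; rewrite domM in Mz.
have [_ isoI] := (has_isotropic_curveP _ _).1 (image_isotropic_curve (A := A) isoC).
by rewrite eqM // isoI // -dual_mxE.
Qed.

Lemma dual_curve_minimal A C M : elliptic_catenoid C -> lorentz_mx A ->
  dom M = setT -> has_isotropic_curve M (dual_curve A) -> minimal_surface M.
Proof.
move=> /elliptic_catenoid_curve [domC isoC sc hol [z0 nz]] hA domM isoM.
apply: (has_isotropic_curve_conformal domM isoM).
- exact: sc.
- exact/holomorphic_mulmx/holomorphic_mulmx.
- by move=> z; exact: dual_curve_isotropic.
(* The Hermitian norm vanishes only at the zero vector. A zero dual curve at [z0] would make the
   Lorentz image vanish there, hence also the Lorentzian norm of the catenoid curve, which is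
   nonzero at [z0]. *)
- exists z0; apply: euclidean_norm_neq0; apply: contra_neq nz => Av0.
  rewrite -(lorentz_norm _ hA).
  have v0 : complex_mx A *m catenoid_curve z0 = 0.
    move: Av0; rewrite /dual_curve dual_mxE => /colP v0.
    have i0 : 'i%C != 0 :> R[i] by rewrite eq_complex /= oner_eq0 andbF.
    apply: cV3P; rewrite [RHS]mxE.
    + by have /eqP := v0 0; rewrite col3E [X in _ == X]mxE
        mulf_eq0 (negPf i0) => /eqP.
    + by have /eqP := v0 1; rewrite col3E [X in _ == X]mxE
        mulf_eq0 (negPf i0) => /eqP.
    + by have := v0 2; rewrite col3E [RHS]mxE.
  by rewrite v0 !mxE !normr0 expr0n /= mulr0 !addr0.
Qed.

Lemma dual_surface_catenoid_neq0 A C : elliptic_catenoid C -> lorentz_mx A ->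
  dual_surface (image_surface A C) !=set0.
Proof.
move=> hC hA; have [domC isoC _ _ _] := elliptic_catenoid_curve hC.
have isoI := image_isotropic_curve (A := A) isoC.
have isoJ := image_isotropic_curve (A := A) adjoint_catenoid_isotropic_curve.
(* The factors i in the first two rows of [dual_mx] call for the coordinates of the adjoint image;
   the factor 1 in the third keeps that of the image of [C]. *)
pose M : surface R := Surface setT (fun z =>
  let X := image_surface A C in let Y := image_surface A adjoint_catenoid in
  col3 (pos Y z 0 0) (pos Y z 1 0) (pos X z 2 0)).
have isoM : has_isotropic_curve M (dual_curve A).
  move=> z + _; have Cz : dom C z by rewrite domC.
  have slice_j j : x_slice M z j = if j == 2 then x_slice (image_surface A C) z 2
     else x_slice (image_surface A adjoint_catenoid) z j.
    by apply/funext => x; move: j; apply: ord3_case; rewrite /x_slice col3E.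
  have yslice_j j : y_slice M z j = if j == 2 then y_slice (image_surface A C) z 2
     else y_slice (image_surface A adjoint_catenoid) z j.
    by apply/funext => x; move: j; apply: ord3_case; rewrite /y_slice col3E.
  apply: ord3_case; rewrite slice_j yslice_j /= /dual_curve dual_mxE col3E.
  + by have := isoJ z 0 I; rewrite -scalemxAr mxE.
  + by have := isoJ z 1 I; rewrite -scalemxAr mxE.
  + exact: isoI.
exists M; split.
- exact: image_catenoid_maximal.
- exact: (dual_curve_minimal hC hA).
- exact/esym/domC.
- move=> z Cz; have [_ ->] := (has_isotropic_curveP _ _).1 isoI; last exact: Cz.
  have [_ ->] := (has_isotropic_curveP _ _).1 isoM; last exact: I.
  by rewrite /dual_curve dual_mxE.
Qed.

(** * Goursat transformations between the duals *)

(** The hypothesis says that J A^T J is a left inverse of A, hence a right inverse as well. *)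
Lemma lorentz_mxT A : lorentz_mx A -> A *m lorentz_form *m A^T = lorentz_form.
Proof.
have JJ : lorentz_form *m lorentz_form = 1%:M.
  by apply/matrixP; apply: ord3_case; apply: ord3_case;
     rewrite mulmx_mx3 !mxE /=; ring.
move=> hA; have : lorentz_form *m A^T *m lorentz_form *m A = 1%:M.
  by rewrite -!mulmxA (mulmxA A^T) hA.
move/mulmx1C; rewrite !mulmxA => /(congr1 (mulmx ^~ lorentz_form)).
by rewrite -(mulmxA _ lorentz_form lorentz_form) JJ mulmx1 mul1mx.
Qed.

Lemma dual_mx_sqr : dual_mx *m dual_mx = - complex_mx lorentz_form.
Proof.
apply/matrixP; apply: ord3_case; apply: ord3_case;
  rewrite mulmx_mx3 !mxE /= !(rmorph0, rmorph1, rmorphN1) ?mulr1n ?mulr0n;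
  have i2 := sqr_i; by ring: i2.
Qed.

(* As D^2 = - J and A^-1 = J A^T J, G is D A B^-1 D^-1. *)
Lemma orthogonal_conjugate (K : comNzRingType) n (D J A B : 'M[K]_n)
    (G := - (D *m A *m J *m B^T *m D)) :
  D^T = D -> J^T = J -> J *m J = 1%:M -> D *m D = - J ->
  A *m J *m A^T = J -> B^T *m J *m B = J ->
  G *m G^T = 1%:M /\ D *m A = G *m (D *m B).
Proof.
move=> DT JT JJ DD AJ BJ.
have JD : J *m D = D *m J by rewrite -[J]opprK -DD mulmxN mulNmx mulmxA.
(* This product is the middle factor both of G D B and of G G^T. *)
have BD : B^T *m D *m (D *m B) = - J.
  by rewrite mulmxA -(mulmxA B^T) DD mulmxN mulNmx BJ.
rewrite {}/G; split; last first.
  rewrite mulNmx -(mulmxA _ B^T) -(mulmxA _ (B^T *m D)) BD mulmxN opprK.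
  by rewrite -(mulmxA _ J J) JJ mulmx1.
have trG : (D *m A *m J *m B^T *m D)^T = D *m B *m (J *m A^T *m D).
  by rewrite !trmx_mul trmxK DT JT !mulmxA.
rewrite linearN /= mulmxN mulNmx opprK trG -(mulmxA _ B^T) (mulmxA _ (D *m B)).
rewrite -(mulmxA _ (B^T *m D)) BD mulmxN mulNmx.
rewrite -(mulmxA _ J J) JJ mulmx1 !mulmxA -2!(mulmxA D) AJ -mulmxA JD.
by rewrite mulmxA DD mulNmx opprK.
Qed.

Lemma dual_curve_goursat A B : lorentz_mx A -> lorentz_mx B ->
  exists2 G : 'M[R[i]]_3, G *m G^T = 1%:M &
    forall z, dual_curve A z = G *m dual_curve B z.
Proof.
pose J := complex_mx lorentz_form.
(* [orthogonal_conjugate] uses the two matrices on opposite sides: A J A^T = J for the first, B^T J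
   B = J for the second. *)
move=> /lorentz_mxT/(congr1 (map_mx (real_complex R))) hA.
move=> /(congr1 (map_mx (real_complex R))) hB.
rewrite !map_mxM -!map_trmx in hA hB.
have JJ : J *m J = 1%:M.
  by apply/matrixP; apply: ord3_case; apply: ord3_case;
     rewrite mulmx_mx3 !mxE /= !(rmorph0, rmorph1, rmorphN1); ring.
have JT : J^T = J.
  by apply/matrixP; apply: ord3_case; apply: ord3_case; rewrite !mxE.
have DT : dual_mx^T = dual_mx by rewrite tr_diag_mx.
have [GG DA] := orthogonal_conjugate DT JT JJ dual_mx_sqr hA hB.
move: GG DA; set G := - _ => GG DA; exists G; first exact: GG.
by move=> z; rewrite /dual_curve mulmxA DA -(mulmxA G) -(mulmxA dual_mx).
Qed.

(** * The hyperbolic and parabolic rotations *)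

Lemma ch_sqr (t : R) : ch t ^+ 2 = 1 + sh t ^+ 2.
Proof.
have e : expR (- t) * expR t = 1 by rewrite -expRD addNr expR0.
by rewrite /ch /sh; field: e.
Qed.

Lemma lorentz_hyperbolic_rotation (t : R) : lorentz_mx (hyperbolic_rotation t).
Proof.
have e := ch_sqr t.
apply/matrixP; apply: ord3_case; apply: ord3_case;
  rewrite !mulmx_mx3 !mxE /=; by ring: e.
Qed.

Lemma lorentz_parabolic_rotation (t : R) : lorentz_mx (parabolic_rotation t).
Proof.
apply/matrixP; apply: ord3_case; apply: ord3_case;
  rewrite !mulmx_mx3 !mxE /=; by field.
Qed.

Lemma ch_gt0 (t : R) : 0 < ch t.
Proof. by rewrite divr_gt0 // addr_gt0 // expR_gt0. Qed.

Lemma sh_neq0 (t : R) : t != 0 -> sh t != 0.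
Proof.
apply: contra_neq => /eqP; rewrite mulf_eq0 invr_eq0 pnatr_eq0 orbF subr_eq0.
by move/eqP/expR_inj => tN; lra.
Qed.

(** * Bonnet surfaces as duals of hyperbolic images *)

Lemma weierstrass_isotropic (g w : R[i]) (v := weierstrass 1 g w) :
  v 0 0 ^+ 2 + v 1 0 ^+ 2 + 1%:C%C * v 2 0 ^+ 2 = 0.
Proof. by rewrite !col3E rmorph1; have i2 := sqr_i; field: i2. Qed.

(** The combination phi_1 - i phi_2 recovers w. *)
Lemma weierstrass_neq0 (g w : R[i]) : w != 0 -> weierstrass 1 g w != 0.
Proof.
apply: contra_neq => /colP v0; have i2 := sqr_i.
have := v0 0; have := v0 1; rewrite !col3E !mxE rmorph1 => e1 e0.
transitivity ((2^-1 * (1 - 1 * g ^+ 2) * w)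
              - 'i%C * ('i%C / 2 * (1 + 1 * g ^+ 2) * w)).
  by field: i2.
by rewrite e1 e0 mulr0 subrr.
Qed.

(** For sg = 1 or -1, this is diag(sg, sg, 1), a half-turn about the third axis when sg = -1,
    followed by the rotation about the second axis whose angle has cosine 1 / cosh t and sine tanh
    t. *)
Definition bonnet_rotation (sg t : R) : 'M[R]_3 :=
  mx3 [:: [:: sg / ch t; 0; sh t / ch t];
          [:: 0; sg; 0];
          [:: - (sg * sh t / ch t); 0; (ch t)^-1]].

Lemma bonnet_rotation_orthogonal (sg t : R) : sg ^+ 2 = 1 ->
  bonnet_rotation sg t *m (bonnet_rotation sg t)^T = 1%:M.
Proof.
move=> sg2; have c2 := ch_sqr t; have c0 := lt0r_neq0 (ch_gt0 t).
by apply/matrixP; apply: ord3_case; apply: ord3_case;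
   rewrite mulmx_mx3 !mxE /=; field: sg2 c2.
Qed.

Lemma det_bonnet_rotation (sg t : R) : sg ^+ 2 = 1 ->
  \det (bonnet_rotation sg t) = 1.
Proof.
move=> sg2; have c2 := ch_sqr t; have c0 := lt0r_neq0 (ch_gt0 t).
by rewrite det_mx33 !mxE /=; field: sg2 c2.
Qed.

(** A logarithm of i sg / cosh t. This shift turns the second dual coordinate cosh t sinh z + i sinh
    t into i sg (e^z + cosh^2 t e^(-z)) / 2 + i sinh t, which is sg times the Bonnet one, since 1 +
    lambda^2 = cosh^2 t. *)
Definition bonnet_shift (sg t : R) : Cplx R :=
  (- ln (ch t) +i* (sg * (pi / 2)))%C.

Lemma cexp_bonnet_shift (sg t : R) : sg ^+ 2 = 1 ->
  cexp (bonnet_shift sg t) = 'i%C * sg%:C%C / (ch t)%:C%C /\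
  cexp (- bonnet_shift sg t) = - 'i%C * sg%:C%C * (ch t)%:C%C.
Proof.
move=> sg2; have c_gt0 := ch_gt0 t.
have [cos0 sin1] : cos (sg * (pi / 2)) = 0 /\ sin (sg * (pi / 2)) = sg.
  have : (sg == 1) || (sg == -1) by rewrite -eqf_sqr sg2 expr1n.
  case/orP => /eqP ->; first by rewrite mul1r cos_pihalf sin_pihalf.
  by rewrite mulN1r cosN sinN cos_pihalf sin_pihalf.
rewrite -fmorphV /cexp /= cosN sinN cos0 sin1 opprK expRN lnK ?posrE //.
by split; congr Complex; rewrite /=; ring.
Qed.

Lemma dual_hyperbolic_curve (sg t : R) z : sg ^+ 2 = 1 ->
  complex_mx (bonnet_rotation sg t)^T
    *m dual_curve (hyperbolic_rotation t) (z + bonnet_shift sg t)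
  = weierstrass 1 (cexp z + (sg * sh t)%:C%C) (cexp (- z)).
Proof.
move=> sg2; have [eb eNb] := cexp_bonnet_shift t sg2.
have ez := cexpN_mul z; have i2 := sqr_i.
have c0 : (ch t)%:C%C != 0 :> R[i].
  by rewrite fmorph_eq0 lt0r_neq0 // ch_gt0.
have c2 : (ch t)%:C%C ^+ 2 = 1 + (sh t)%:C%C ^+ 2 :> R[i].
  by rewrite -!rmorphXn ch_sqr rmorphD rmorph1.
have s2 : sg%:C%C ^+ 2 = 1 :> R[i] by rewrite -rmorphXn sg2 rmorph1.
rewrite /bonnet_rotation /hyperbolic_rotation.
(* Only the algebraic relations collected above are needed now; the shift and the hyperbolic
   functions become atoms for [field]. *)
move: (bonnet_shift sg t) (ch t) (sh t) eb eNb c0 c2 => b c s eb eNb c0 c2.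
apply: cV3P; rewrite mulmx_col3 /dual_curve dual_mxE !col3E !mulmx_col3
  catenoid_curveE !col3E opprD !cexpD eb eNb !mxE /=
  !(rmorph0, rmorph1, rmorphN, rmorphM, fmorphV) /=;
  by field: ez i2 c2 s2.
Qed.

Lemma biholomorphic_translation (a : Cplx R) :
  biholomorphic setT setT (fun z : Cplx R => z + a).
Proof.
split; first by apply: (holomorphic_shift (f := id)) => z _; exact: derivable_id.
split=> [z _|z w _ _ /addIr|w _]; [exact: I | exact |].
by exists (w - a); [exact: I | rewrite subrK].
Qed.

Lemma dual_hyperbolic_bonnet C M (t : R) : elliptic_catenoid C -> t != 0 ->
  dual_surface (image_surface (hyperbolic_rotation t) C) M -> bonnet_surface M.
Proof.
move=> hC t0 /(dual_surface_catenoidP hC) [minM domM isoM].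
have [_ _ sc hol _] := elliptic_catenoid_curve hC.
(* This sign makes lambda = sg sinh t = |sinh t| positive whatever the sign of t. *)
pose sg := Num.sg (sh t).
have sg2 : sg ^+ 2 = 1 by rewrite sqr_sg sh_neq0.
have sg_gt0 : 0 < sg * sh t by rewrite -normrEsg normr_gt0 sh_neq0.
set A := bonnet_rotation sg t; set b := bonnet_shift sg t.
have AA : A *m A^T = 1%:M by exact: bonnet_rotation_orthogonal.
(* The Bonnet model is built from [M] by the inverse motion, so the similarity is immediate and only
   its curve has to be identified. *)
pose B := image_surface A^T (translate b M).
have domB : dom B = setT by apply/seteqP; split=> z //= _; rewrite domM.
have isoB : has_isotropic_curve B
    (fun z => weierstrass 1 (cexp z + (sg * sh t)%:C%C) (cexp (- z))).
  have := image_isotropic_curve (A := A^T) (translate_isotropic_curve (a := b) isoM).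
  by apply: eq_has_isotropic_curve => z; exact: dual_hyperbolic_curve.
split; first exact: minM.
exists (sg * sh t), B; split; first exact: sg_gt0.
- split; [|exact: domB | by have [] := (has_isotropic_curveP _ _).1 isoB].
  apply: (has_isotropic_curve_conformal domB isoB); first exact: sc.
  (* Holomorphy of the Bonnet curve is inherited from the catenoid curve through the dual curve. *)
  + move=> j; under eq_fun do rewrite -dual_hyperbolic_curve //.
    apply: holomorphic_mulmx => k.
    apply: (holomorphic_shift (f := fun z => dual_curve _ z k 0)).
    exact/holomorphic_mulmx/holomorphic_mulmx.
  + by move=> z; exact: weierstrass_isotropic.
  + exists 0; apply/euclidean_norm_neq0/weierstrass_neq0.
    by rewrite oppr0 cexp0 oner_eq0.
- exists (fun z => z - b), A, 1, 0; split.
  + by rewrite domM domB; exact: biholomorphic_translation.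
  + exact: AA.
  + exact: det_bonnet_rotation.
  + exact: ltr01.
  + by move=> z _; rewrite scale1r addr0 /= mulmxA AA mul1mx subrK.
Qed.

End Isotropic_curves.

Theorem theorem5p2 (R : realType) (C : surface R) (hC : elliptic_catenoid C) :
  (forall t : R, t != 0 ->
     let D := dual_surface (image_surface (hyperbolic_rotation t) C) in
     D !=set0 /\ forall M : surface R, D M -> bonnet_surface M) /\
  (forall t : R,
     let D := dual_surface (image_surface (parabolic_rotation t) C) in
     D !=set0 /\
     forall M : surface R, D M ->
       exists2 N : surface R, bonnet_surface N & goursat_transform N M).
Proof.
have dual_hyperbolic t :=
  dual_surface_catenoid_neq0 hC (lorentz_hyperbolic_rotation t).
split=> t.
  move=> t0 /=; split; first exact: dual_hyperbolic.
  by move=> M; exact: dual_hyperbolic_bonnet.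
split; first exact: dual_surface_catenoid_neq0 (lorentz_parabolic_rotation t).
(* Any nonzero parameter gives a Bonnet surface [N]; here it is 1. The matrix [G] below carries the
   curve of [N] to that of [M]. *)
move=> M dualM; have [N dualN] := dual_hyperbolic 1.
exists N; first by apply: (dual_hyperbolic_bonnet hC _ dualN); exact: oner_neq0.
have [minM domM /has_isotropic_curveP[_ isoM]] := dual_surface_catenoidP hC dualM.
have [minN domN /has_isotropic_curveP[_ isoN]] := dual_surface_catenoidP hC dualN.
have [G GG dualG] := dual_curve_goursat (lorentz_parabolic_rotation t)
  (lorentz_hyperbolic_rotation 1).
split; [exact: minN | exact: minM | by rewrite domM domN |].
exists G; first exact: GG.
by move=> z Nz; rewrite isoN // isoM ?domM // dualG.
Qed.
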